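(* Let $X$ be an infinite normal Hausdorff topological space and let $H=\mathrm{C}_p^{*}(X)$. Let either $\Phi=\Omega$ and $\tilde\Phi^{\uparrow}=\mathcal D^{\uparrow}$, or $\Phi=\Gamma$ and $\tilde\Phi^{\uparrow}=\mathcal S^{\uparrow}$. Then the following are equivalent: (a) $H$ satisfies the selection principle $\mathrm S_1(\tilde\Phi^{\uparrow}(H),\mathcal D(H))$. (b) $iw(X)=\aleph_0$ and $X$ has the covering property $\mathrm S_1(\Phi^{sh}(X),\Omega(X))$. (c) $H$ is separable and satisfies the selection principle $\mathrm S_1(\Phi_{\mathbf 0}(H),\Omega_{\mathbf 0}(H))$. (d) $H$ is separable and satisfies the selection principle $\mathrm S_1(\tilde\Phi^{\uparrow}(H),\Omega_{\mathbf 0}(H))$.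
   Context: The set ${}^X\mathbb R$ of all real functions on $X$ carries the product topology (pointwise convergence). $\mathrm{C}_p^{*}(X)$ is the subspace of all bounded continuous functions $X\to\mathbb R$. $\mathbf 0$ is the constant zero function on $X$. The $i$-weight $iw(X)$ is the smallest infinite cardinal $\kappa$ such that $X$ can be mapped by a one-to-one continuous mapping onto a Tychonoff space of weight at most $\kappa$. Covers: an $\omega$-cover of $X$ is a cover $\mathcal U$ with $X\notin\mathcal U$ such that every finite $F\subseteq X$ is contained in some $U\in\mathcal U$. A $\gamma$-cover is an infinite cover $\mathcal U$ such that for every $x\in X$ the set $\{U\in\mathcal U:x\notin U\}$ is finite. $\Omega(X)$ is the family of all open $\omega$-covers. For $\varphi\in\{\omega,\gamma\}$ a $\varphi$-cover $\mathcal U$ is shrinkable if there is an open $\varphi$-cover $\mathcal W$ such that for every $W\in\mathcal W$ there is $U\in\mathcal U$ with $\overline W\subseteq U$. $\Omega^{sh}(X)$, $\Gamma^{sh}(X)$ are the families of all open shrinkable $\omega$-covers, resp. open shrinkable $\gamma$-covers. $\mathrm S_1(\mathcal A,\mathcal B)$, for families $\mathcal A,\mathcal B$ of subsets of a set: for every sequence $\langle A_n:n\in\omega\rangle$ of elements of $\mathcal A$ there are $a_n\in A_n$ ($n\in\omega$) with $\{a_n:n\in\omega\}\in\mathcal B$. For $h\in{}^X\mathbb R$ and a family $F$ of real functions on $X$: $F$ has property $(\Omega_h)$ if $h\notin F$ and $h\in\overline F$ in ${}^X\mathbb R$; $F$ has property $(\Gamma_h)$ if $F$ is infinite and for every $\varepsilon>0$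 and $x\in X$ the set $\{f\in F:|f(x)-h(x)|\ge\varepsilon\}$ is finite. For $H\subseteq{}^X\mathbb R$, $\Phi_h(H)$ is the set of all $F\subseteq H$ having property $(\Phi_h)$ and such that $f\ge h$ and $f-h\in H$ for every $f\in F$. For $F\subseteq H\subseteq{}^X\mathbb R$: $\mathcal D(H)$ is the set of all $F\subseteq H$ dense in $H$. $F$ is upper sequentially dense in $H$ if for every $f\in H$ there is a sequence $\langle h_n:n\in\omega\rangle$ of elements of $F$ with $h_n\to f$ pointwise, $h_n\ge f$ and $h_n-f\in H$ for all $n$. $F$ is upper dense in $H$ if for every $f\in H$ the set $\{h\in F:h\ge f\wedge h-f\in H\}$ is dense in $\{h\in H:h\ge f\}$. $\mathcal S^{\uparrow}(H)$, $\mathcal D^{\uparrow}(H)$ are the sets of all upper sequentially dense, resp. upper dense, subsets of $H$. *)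

(* Defs.v *)
From mathcomp Require Import all_boot all_order all_algebra.
From mathcomp Require Import all_classical all_reals all_analysis.

Set Implicit Arguments.
Unset Strict Implicit.
Unset Printing Implicit Defensive.

Import Order.TTheory GRing.Theory Num.Theory.
Import numFieldNormedType.Exports.

Local Open Scope classical_set_scope.
Local Open Scope ring_scope.

Definition S1 (T : Type) (A B : set (set T)) : Prop :=
  forall A_ : nat -> set T, (forall n, A (A_ n)) ->
    exists a : nat -> T, (forall n, A_ n (a n)) /\ B (range a).

(* The symbol Phi: [Omega] goes with upper density, [Gamma] with upper
   sequential density. *)
Variant kind := Omega | Gamma.

Section Covers.
Context {X : topologicalType}.
Implicit Types U W : set (set X).

(* As usual for selection principles, covers are nontrivial: X itself is never
   a member. This matters for gamma-covers: otherwise any open gamma-cover U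
   would become shrinkable by adding X to it, every open gamma-cover being then
   a refinement witness, and an infinite Hausdorff X always has one. *)
Definition is_cover U : Prop := cover U id = setT /\ ~ U setT.

Definition omega_cover U : Prop :=
  is_cover U /\
  forall F : set X, finite_set F -> exists2 V, U V & F `<=` V.

Definition gamma_cover U : Prop :=
  [/\ is_cover U, infinite_set U
    & forall x, finite_set [set V | U V /\ ~ V x]].

Definition kind_cover (k : kind) : set (set (set X)) :=
  match k with Omega => omega_cover | Gamma => gamma_cover end.

Definition open_covers (k : kind) : set (set (set X)) :=
  [set U | kind_cover k U /\ U `<=` open].

Definition shrinkable (k : kind) U : Prop :=
  exists2 W, open_covers k W &
    forall V, W V -> exists2 V', U V' & closure V `<=` V'.

Definition shrinkable_covers (k : kind) : set (set (set X)) :=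
  [set U | open_covers k U /\ shrinkable k U].

End Covers.
Arguments open_covers : clear implicits.
Arguments shrinkable_covers : clear implicits.

(* Cardinals are represented by types. *)
Definition weight_le (Y : topologicalType) (K : Type) : Prop :=
  exists2 B : set (set Y), basis B & (B #<= [set: K])%card.

Definition tychonoff_space (Y : topologicalType) : Prop :=
  completely_regular_space Y /\ hausdorff_space Y.

Definition condenses_le (X : topologicalType) (K : Type) : Prop :=
  exists (Y : topologicalType) (f : X -> Y),
    [/\ continuous f, bijective f, tychonoff_space Y & weight_le Y K].

Definition iweight_eq (X : topologicalType) (K : Type) : Prop :=
  [/\ infinite_set [set: K], condenses_le X K
    & forall L : Type, infinite_set [set: L] -> condenses_le X L ->
        ([set: K] #<= [set: L])%card].

Section FunctionSpaces.
Context {R : realType} {X : topologicalType}.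
Implicit Types (f g h : {ptws X -> R}) (D F H : set {ptws X -> R}).

Definition fle f g : Prop := forall x, f x <= g x.

Definition fsub f g : {ptws X -> R} := fun x => f x - g x.

Definition dense_in D H : Prop := D `<=` H /\ H `<=` closure D.

Definition separable H : Prop := exists2 D, countable D & dense_in D H.

Definition dense_subsets H : set (set {ptws X -> R}) := [set D | dense_in D H].

Definition Omega_at h F : Prop := ~ F h /\ closure F h.

Definition Gamma_at h F : Prop :=
  infinite_set F /\
  forall (e : R) (x : X), 0 < e ->
    finite_set [set f | F f /\ e <= `|f x - h x|].

Definition kind_at (k : kind) : {ptws X -> R} -> set {ptws X -> R} -> Prop :=
  match k with Omega => Omega_at | Gamma => Gamma_at end.

Definition families_at (k : kind) h H : set (set {ptws X -> R}) :=
  [set F | [/\ F `<=` H, kind_at k h F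
             & forall f, F f -> fle h f /\ H (fsub f h)]].

Definition upper_sequentially_dense H F : Prop :=
  F `<=` H /\
  forall f, H f -> exists h_ : nat -> {ptws X -> R},
    [/\ forall n, F (h_ n),
        forall x, h_ n x @[n --> \oo] --> f x
      & forall n, fle f (h_ n) /\ H (fsub (h_ n) f)].

Definition upper_dense H F : Prop :=
  F `<=` H /\
  forall f, H f ->
    dense_in [set h | F h /\ (fle f h /\ H (fsub h f))]
             [set h | H h /\ fle f h].

Definition upper_dense_subsets (k : kind) H : set (set {ptws X -> R}) :=
  match k with
  | Omega => upper_dense H
  | Gamma => upper_sequentially_dense H
  end.

End FunctionSpaces.

Definition Cp_bounded (R : realType) (X : topologicalType)
    : set {ptws X -> R} :=
  [set f | continuous (f : X -> R) /\ bounded_fun (f : X -> R)].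

Definition zero_fun (R : realType) (X : topologicalType) : {ptws X -> R} :=
  fun=> 0.

Arguments Cp_bounded : clear implicits.
Arguments zero_fun : clear implicits.

(* Main.v *)
(* A continuous g dominating f, equal to f on a set W and at least 1 off an open
   U containing the closure of W, exists by Urysohn's lemma; hence the bounded
   functions that are at least 1 off some member of a shrinkable cover form an
   upper (sequentially) dense set, and a dense selection from such sets picks an
   omega-cover. Conversely, the sublevel sets {f < 1/(n+1)} turn families
   accumulating at 0 from above into shrinkable covers. Upper (sequentially)
   dense sets are translation invariant, so accumulation at 0 gives
   density once there is a countable dense set to translate by.
   Separability itself is equivalent to countable i-weight: a countable dense
   set evaluates X injectively into a countable power of the line, and a
   countable base of a coarser Tychonoff topology gives countably many functions
   whose rational polynomials are dense. *)
Require Import Defs.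
From mathcomp Require Import all_boot all_order all_algebra.
From mathcomp Require Import all_classical all_reals all_analysis.
From mathcomp Require Import lra.

Set Implicit Arguments.
Unset Strict Implicit.
Unset Printing Implicit Defensive.

Import Order.TTheory GRing.Theory Num.Theory.
Import numFieldNormedType.Exports.

Local Open Scope classical_set_scope.
Local Open Scope ring_scope.

(** * Pointwise topology *)

Section Pointwise.
Context {R : realType} {X : topologicalType}.
Implicit Types (f g h : {ptws X -> R}) (F G D : set {ptws X -> R}).

Definition ptws_box h (A : set X) (e : R) : set {ptws X -> R} :=
  [set f | forall x, A x -> `|f x - h x| < e].

Lemma nbhs_ptws_box h A e : finite_set A -> 0 < e -> nbhs h (ptws_box h A e).
Proof.
move=> finA e0.
have evx (x : X) : nbhs h [set f : {ptws X -> R} | `|f x - h x| < e].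
  have prx : (fun f : {ptws X -> R} => f x) @ h --> h x.
    exact: (@proj_continuous X (fun=> R) x h).
  by move/cvgrPdistC_lt : prx; exact.
have -> : ptws_box h A e =
    \bigcap_(x in A) [set f : {ptws X -> R} | `|f x - h x| < e] by [].
have [s As] := (@finite_fsetP _ _).1 finA.
rewrite As; apply: filter_bigI => x _; exact: evx.
Qed.

(** The filter generated by the boxes around [h] converges to [h] at every point, hence in the
    pointwise topology, so it contains every neighbourhood of [h]. *)
Lemma nbhs_ptwsP h (B : set {ptws X -> R}) :
  nbhs h B <-> exists A e, [/\ finite_set A, 0 < e & ptws_box h A e `<=` B].
Proof.
split=> [hB|[A [e [finA e0]]]]; last first.
  by move=> /filterS; apply; exact: nbhs_ptws_box.
pose I := [set Ae : set X * R | finite_set Ae.1 /\ 0 < Ae.2].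
pose G := filter_from I (fun Ae => ptws_box h Ae.1 Ae.2).
have FG : Filter G.
  apply: filter_from_filter; first by exists (set0, 1); split=> //=.
  move=> [A e] [A' e'] [/= finA e0] [/= finA' e'0].
  exists (A `|` A', Num.min e e').
    by split=> /=; [rewrite finite_setU|rewrite lt_min e0 e'0].
  move=> f /= fh; split=> x Ax.
    by have := fh x (or_introl Ax); rewrite lt_min => /andP[].
  by have := fh x (or_intror Ax); rewrite lt_min => /andP[].
have Gh : G --> h.
  apply/pointwise_cvgP => x; apply/cvgrPdist_lt => e e0.
  exists ([set x], e); first by split=> //=; exact: finite_set1.
  by move=> f /= /(_ x erefl); rewrite distrC.
by have [[A e] [/= finA e0] AeB] := Gh _ hB; exists A, e.
Qed.

Lemma ptws_closureP F h :
  closure F h <-> forall A e, finite_set A -> 0 < e ->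
    exists2 f, F f & forall x, A x -> `|f x - h x| < e.
Proof.
split=> [clF A e finA e0|boxF B /nbhs_ptwsP[A [e [finA e0 AeB]]]].
  by have [f [Ff fh]] := clF _ (nbhs_ptws_box h finA e0); exists f.
by have [f Ff fh] := boxF A e finA e0; exists f; split=> //; exact: AeB.
Qed.

End Pointwise.

Section BoundedContinuous.
Context {R : realType} {X : topologicalType}.
Local Notation H := (Cp_bounded R X).
Implicit Types f g : {ptws X -> R}.

Lemma Cp_boundedP f :
  H f <-> continuous (f : X -> R) /\ exists M : R, forall x, `|f x| <= M.
Proof.
split=> [[cf [M [_ fM]]]|[cf [M fM]]]; split=> //.
  by exists (M + 1) => x; apply: (fM (M + 1)) => //; rewrite ltrDl.
exists M; split; first by rewrite num_real.
by move=> y My x _ /=; apply: le_trans (fM x) (ltW My).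
Qed.

Lemma Cp_bounded_cst (c : R) : H (fun=> c).
Proof. by apply/Cp_boundedP; split; [exact: cst_continuous|exists `|c|]. Qed.

Lemma Cp_boundedD f g : H f -> H g -> H (fun x => f x + g x).
Proof.
move=> /Cp_boundedP[cf [M fM]] /Cp_boundedP[cg [N gN]]; apply/Cp_boundedP.
split; first by move=> x; apply: (@cvgD _ R^o _ _ _ f g); [exact: cf|exact: cg].
by exists (M + N) => x; apply: le_trans (ler_normD _ _) (lerD (fM x) (gN x)).
Qed.

Lemma Cp_boundedM f g : H f -> H g -> H (fun x => f x * g x).
Proof.
move=> /Cp_boundedP[cf [M fM]] /Cp_boundedP[cg [N gN]]; apply/Cp_boundedP.
split; first by move=> x; apply: (@cvgM _ _ _ _ f g); [exact: cf|exact: cg].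
by exists (M * N) => x; rewrite normrM ler_pM.
Qed.

Lemma Cp_boundedB f g : H f -> H g -> H (fsub f g).
Proof.
move=> Hf Hg.
have -> : fsub f g = (fun x => f x + (-1) * g x) :> {ptws X -> R}.
  by apply/funext => x; rewrite /fsub mulN1r.
by apply: Cp_boundedD => //; apply: Cp_boundedM => //; exact: Cp_bounded_cst.
Qed.

End BoundedContinuous.

(** * Upper density *)

(** Repetitions make finite sets admissible: an index that codes no element of [D] is sent to the
    default [x0]. *)
Lemma countable_enum (T : Type) (D : set T) :
  D !=set0 -> countable D -> exists d : nat -> T, range d = D.
Proof.
move=> [x0 Dx0] /countable_injP[f finj].
have /choice[d dP] n : exists y, D y /\ forall x, D x -> f x = n -> x = y.
  have [[y [Dy fy]]|nex] := pselect (exists y, D y /\ f y = n).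
    exists y; split=> // x Dx fx; apply: finj; rewrite ?inE//.
    by rewrite fx fy.
  by exists x0; split=> // x Dx fx; case: nex; exists x.
exists d; apply/seteqP; split=> [_ [n _ <-]|x Dx]; first exact: (dP n).1.
by exists (f x) => //; rewrite -((dP (f x)).2 x).
Qed.

Section UpperDense.
Context {R : realType} {X : topologicalType}.
Local Notation H := (Cp_bounded R X).
Local Notation zero := (zero_fun R X).
Implicit Types (f g h : {ptws X -> R}) (F G D : set {ptws X -> R}).

(** It suffices to approximate each [h] from above: an approximation above [h] also lies above every
    [f] below [h], and [H] is closed under differences. *)
Lemma upper_denseP F : upper_dense H F <->
  F `<=` H /\ forall h A e, H h -> finite_set A -> 0 < e ->
    exists g, [/\ F g, fle h g & forall x, A x -> `|g x - h x| < e].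
Proof.
split=> -[FH dF]; split=> //.
  move=> f A e Hf finA e0; have [_ dFf] := dF f Hf.
  have [|g [[Fg [fg _]] gf]] := dFf f _ _ (nbhs_ptws_box f finA e0).
    by split=> // x; exact: lexx.
  by exists g.
move=> f Hf; split=> [h [Fh [fh _]]|h [Hh fh]]; first by split=> //; exact: FH.
apply/ptws_closureP => A e finA e0; have [g [Fg hg gh]] := dF h A e Hh finA e0.
exists g => //; split=> //; split; first by move=> x; exact: le_trans (hg x).
by apply: Cp_boundedB => //; exact: FH.
Qed.

Lemma upper_dense_subset k F : upper_dense_subsets k H F -> F `<=` H.
Proof. by case: k => -[]. Qed.

Lemma upper_dense_full k : upper_dense_subsets k H H.
Proof.
have fsubff f : H (fsub f f).
  have -> : fsub f f = (fun=> 0) by apply/funext => x; rewrite /fsub subrr.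
  exact: Cp_bounded_cst.
case: k => /=.
  apply/upper_denseP; split=> // h A e Hh finA e0; exists h; split=> // x.
  by rewrite subrr normr0.
split=> // f Hf; exists (fun=> f); split=> // [x|_]; first exact: cvg_cst.
by split=> // x; exact: lexx.
Qed.

(** Approximating [f + h] from above inside [F] and subtracting [h] approximates [f]. *)
Lemma upper_dense_translate k F h : H h -> upper_dense_subsets k H F ->
  upper_dense_subsets k H [set fsub f h | f in F].
Proof.
move=> Hh.
have addH f : H f -> H (fun x => f x + h x) by move=> Hf; exact: Cp_boundedD.
case: k => /= [/upper_denseP|] [FH dF].
  apply/upper_denseP; split.
    by move=> _ [f Ff <-]; apply: Cp_boundedB => //; exact: FH.
  move=> f A e Hf finA e0; have [g [Fg fg gf]] := dF _ A e (addH _ Hf) finA e0.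
  exists (fsub g h); split; first by exists g.
    by move=> x; rewrite /fsub lerBrDr.
  by move=> x Ax; rewrite /fsub -addrA -opprD [h x + _]addrC; exact: gf.
split; first by move=> _ [f Ff <-]; apply: Cp_boundedB => //; exact: FH.
move=> f Hf; have [u [Fu uf fu]] := dF _ (addH _ Hf).
exists (fun n => fsub (u n) h); split=> [n|x|n].
- by exists (u n).
- rewrite -[f x](addrK (h x)).
  by apply: (@cvgB _ R^o); [exact: uf|exact: cvg_cst].
- have [le_fu _] := fu n; split; first by move=> x; rewrite /fsub lerBrDr.
  by do 2?apply: Cp_boundedB => //; exact: FH.
Qed.

Lemma upper_dense_nonempty k F : upper_dense_subsets k H F -> F !=set0.
Proof.
have H0 : H (fun=> 0) by exact: Cp_bounded_cst.
case: k => /= [/upper_denseP|] [_ dF].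
  have [g [Fg _ _]] := dF _ set0 1 H0 (@finite_set0 _) ltr01; by exists g.
by have [u [Fu _ _]] := dF _ H0; exists (u 0%N).
Qed.

(** The sequence of sets is split into countably many rows by coding pairs. Row [i] is translated by
    [- d i]; a selection accumulating at 0 there translates back to one accumulating at [d i]. *)
Lemma S1_upper_dense_dense k : separable H ->
  S1 (upper_dense_subsets k H) (families_at Omega zero H) ->
  S1 (upper_dense_subsets k H) (dense_subsets H).
Proof.
move=> [D cD [DH HD]] S F dF.
have D0 : D !=set0.
  have [f [Df _]] := HD _ (Cp_bounded_cst 0) setT filterT.
  by exists f.
have [d dD] := countable_enum D0 cD.
have Hd i : H (d i) by apply: DH; rewrite -dD; exists i.
have /choice[a aP] i : exists a : nat -> {ptws X -> R},
    (forall j, F (pickle (i, j)) (a j)) /\ closure (range a) (d i).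
  have [b [Fb [_ [_ b0] _]]] :=
    S (fun j => [set fsub f (d i) | f in F (pickle (i, j))])
      (fun j => upper_dense_translate (Hd i) (dF _)).
  have /choice[a aP] j : exists f, F (pickle (i, j)) f /\ fsub f (d i) = b j.
    by have [f Ff <-] := Fb j; exists f.
  exists a; split=> [j|]; first exact: (aP j).1.
  apply/ptws_closureP => A e finA e0.
  have [_ [j _ <-] bj] := (ptws_closureP _ _).1 b0 A e finA e0.
  exists (a j); first by exists j.
  by move=> x /bj; rewrite -(aP j).2 /zero_fun subr0.
have /choice[c Fc] n := upper_dense_nonempty (dF n).
(* Indices that code no pair receive the default choice [c n]. *)
pose s n :=
  if pickle_inv n is Some ij then a (ij : nat * nat).1 ij.2 else c n.
have sE i j : s (pickle (i, j)) = a i j by rewrite /s pickleK_inv.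
have Fs n : F n (s n).
  rewrite /s; case E : pickle_inv => [[i j]|//] /=.
  have := @pickle_invK (nat * nat)%type n; rewrite E /= => <-.
  exact: (aP i).1.
exists s; split=> //; split.
  by move=> _ [n _ <-]; exact: upper_dense_subset (Fs n).
(* The closure of [range s] is closed, so it need only contain [D]. *)
apply: (subset_trans HD); rewrite [X in _ `<=` X](closure_id _).1;
  last exact: closed_closure.
apply: closureS; rewrite -dD => _ [i _ <-].
apply: closureS (aP i).2 => _ [j _ <-].
by exists (pickle (i, j)).
Qed.

End UpperDense.

(** * From upper dense sets to families accumulating at zero *)

Section Families.
Context {R : realType} {X : topologicalType}.
Local Notation H := (Cp_bounded R X).
Local Notation zero := (zero_fun R X).
Implicit Types (f g h : {ptws X -> R}) (F G D : set {ptws X -> R}).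

(** Index [N] is ruled out by adding to [A] a point where [u N] differs from [h] and taking a radius
    no larger than that difference. *)
Lemma closure_range_infinitely_often (u : nat -> {ptws X -> R}) h :
  ~ range u h -> closure (range u) h ->
  forall N A e, finite_set A -> 0 < e ->
    exists n, (N <= n)%N /\ forall x, A x -> `|u n x - h x| < e.
Proof.
move=> uh /ptws_closureP clu; elim=> [|N IH] A e finA e0.
  by have [_ [n _ <-] un] := clu A e finA e0; exists n.
have [x unx] : exists x, u N x != h x.
  apply/not_existsP => uNh; apply: uh; exists N => //.
  by apply/funext => x; apply/eqP/negPn/negP => /uNh.
have d0 : 0 < `|u N x - h x| by rewrite normr_gt0 subr_eq0.
have [||n [Nn un]] := IH (x |` A) (Num.min e `|u N x - h x|).
- by rewrite finite_setU; split=> //; exact: finite_set1.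
- by rewrite lt_min e0.
exists n; split; last first.
  by move=> y Ay; have := un y (or_intror Ay); rewrite lt_min => /andP[].
rewrite ltn_neqAle Nn andbT; apply/eqP => Nn'.
by have := un x (or_introl erefl); rewrite -Nn' lt_min ltxx andbF.
Qed.

(** Each term differs from the limit somewhere, so it recurs only finitely often; hence the range is
    infinite. *)
Lemma Gamma_at_range (u : nat -> {ptws X -> R}) h :
  (forall n, u n <> h) -> (forall x, u n x @[n --> \oo] --> h x) ->
  Gamma_at h (range u).
Proof.
move=> uh cvu.
have fin (e : R) x : 0 < e ->
    exists N, forall n, (N <= n)%N -> `|u n x - h x| < e.
  move=> e0; have /cvgrPdistC_lt/(_ e e0)[N _ uN] := cvu x.
  by exists N => n Nn; exact: uN.
split=> [finu|e x e0].
  apply: infinite_nat; rewrite (_ : [set: nat] =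
      \bigcup_(f in range u) [set n | u n = f]); last first.
    by apply/seteqP; split=> // n _; exists (u n) => //; exists n.
  apply: bigcup_finite => // _ [m _ <-].
  have [x umx] : exists x, u m x != h x.
    apply/not_existsP => umh; apply: (uh m).
    by apply/funext => x; apply/eqP/negPn/negP => /umh.
  have [|N uN] := fin `|u m x - h x| x; first by rewrite normr_gt0 subr_eq0.
  apply: sub_finite_set (finite_II N) => n /= un.
  rewrite ltnNge; apply/negP => /uN; by rewrite un ltxx.
have [N uN] := fin e x e0.
apply: sub_finite_set (finite_image u (finite_II N)) => _ [[n _ <-] eun].
exists n => //=; rewrite ltnNge; apply/negP => /uN.
by rewrite ltNge eun.
Qed.

(* A sequence in F converging to 0 from above may be eventually 0, and then its
   range is finite; so one approximates a small constant c outside F instead,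
   or takes constants if F contains arbitrarily small ones. *)
Lemma upper_dense_families k F (x0 : X) N : upper_dense_subsets k H F ->
  exists (G : set {ptws X -> R}) (c : R),
    [/\ families_at k zero H G, 0 <= c <= N.+1%:R^-1
      & forall g, G g -> F (fun x => g x + c)].
Proof.
have fsub0 f : fsub f zero = f by apply/funext => x; rewrite /fsub subr0.
have cst_gt0 (c : R) : 0 < c -> (fun=> c) <> zero :> {ptws X -> R}.
  by move=> c0 /(congr1 (@^~ x0))/eqP; rewrite gt_eqF.
case: k => /= [/upper_denseP|] [FH dF].
  exists [set f | [/\ F f, fle zero f & f <> zero]], 0.
  split=> [||g [Fg _ _]].
  - split; first by move=> f [/FH].
      split=> [[]//|]; apply/ptws_closureP => A e finA e0.
      (* Aiming above the constant [e / 2] instead of 0 keeps the approximant nonzero, and being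
         within [e / 2] of that constant keeps it below [e]. *)
      have e20 : 0 < e / 2 by rewrite divr_gt0.
      have [g [Fg eg ge]] := dF _ A _ (Cp_bounded_cst (e / 2)) finA e20.
      exists g.
        split=> // [x|g0]; first exact: le_trans (ltW e20) (eg x).
        by have := eg x0; rewrite g0 leNgt e20.
      move=> x Ax; have := ge x Ax; have := eg x.
      by rewrite !ltr_norml /zero_fun => ? /andP[? ?]; lra.
    by move=> f [/FH Hf zf _]; rewrite fsub0.
  - by rewrite lexx invr_ge0 ler0n.
  - by rewrite (_ : (fun x => _) = g)//; apply/funext => x; rewrite addr0.
have seqG (u : nat -> {ptws X -> R}) : (forall n, H (u n) /\ fle zero (u n)) ->
    (forall n, u n <> zero) -> (forall x, u n x @[n --> \oo] --> (0:R)) ->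
    families_at Gamma zero H (range u).
  move=> Hu u0 cvu; split; last 1 first.
  - by move=> _ [n _ <-]; rewrite fsub0; split; apply Hu.
  - by move=> _ [n _ <-]; apply Hu.
  - exact: Gamma_at_range.
have [often|/existsNP[M rare]] := pselect (forall n : nat, exists m,
    (n <= m)%N /\ F (fun=> m.+1%:R^-1)).
  have [m mP] := choice often.
  exists (range (fun n : nat => (fun=> (m n).+1%:R^-1) : {ptws X -> R})), 0.
  split=> [||_ [n _ <-]].
  - apply: seqG => n.
    + split; first exact: Cp_bounded_cst.
      by move=> x; rewrite /zero_fun invr_ge0 ler0n.
    + by apply: cst_gt0; rewrite invr_gt0 ltr0n.
    + apply/cvgrPdistC_lt => e e0.
      near=> j; rewrite subr0 ger0_norm ?invr_ge0 ?ler0n//.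
      apply: (@le_lt_trans _ _ j.+1%:R^-1).
        by rewrite lef_pV2 ?posrE ?ltr0n// ler_nat ltnS (mP j).1.
      near: j; exact: near_infty_natSinv_lt (PosNum e0).
  - by rewrite lexx invr_ge0 ler0n.
  - rewrite (_ : (fun x => _) = (fun=> (m n).+1%:R^-1)); first exact: (mP n).2.
    by apply/funext => x; rewrite addr0.
(* [M <= m] puts the constant [c] outside [F], and [N <= m] gives the required bound on [c]. *)
pose m := maxn M N; pose c : R := m.+1%:R^-1.
have Fc : ~ F (fun=> c).
  by move=> Fc; apply: rare; exists m; split=> //; exact: leq_maxl.
have [v [Fv cvv cv]] := dF _ (Cp_bounded_cst c).
exists (range (fun n => fsub (v n) (fun=> c))), c; split=> [||_ [n _ <-]].
- apply: seqG => n.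
  + by split=> [|x]; [exact: (cv n).2|rewrite /fsub subr_ge0; exact: (cv n).1].
  + move=> v0; apply: Fc; rewrite (_ : (fun=> c) = v n)//.
    apply/funext => x; apply/eqP; rewrite eq_sym -subr_eq0; apply/eqP.
    exact: (congr1 (@^~ x) v0).
  + by rewrite -(subrr c); apply: (@cvgB _ R^o); [exact: cvv|exact: cvg_cst].
- by rewrite invr_ge0 ler0n /= lef_pV2 ?posrE ?ltr0n// ler_nat ltnS leq_maxr.
- rewrite (_ : (fun x => _) = v n)//.
  by apply/funext => x; rewrite /fsub subrK.
Unshelve. all: by end_near. Qed.

(** The selection is made in families shifted down by constants [c n] and then shifted back. It
    accumulates at 0 along arbitrarily late indices, where [c n] is negligible. *)
Lemma S1_families_upper_dense k (x0 : X) :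
  S1 (families_at k zero H) (families_at Omega zero H) ->
  S1 (upper_dense_subsets k H) (families_at Omega zero H).
Proof.
move=> S F dF.
have /choice[G /choice[c Gc]] n := upper_dense_families x0 n (dF n).
have [g [Gg [_ [g0 clg] Hg]]] := S G (fun n => let: And3 Gn _ _ := Gc n in Gn).
have g_ge0 n x : 0 <= g n x by have [/(_ x)] := Hg _ (imageT g n).
have c_ge0 n : 0 <= c n by have [_ /andP[]] := Gc n.
pose f n : {ptws X -> R} := fun x => g n x + c n.
have Ff n : F n (f n) by have [_ _] := Gc n; exact.
have Hf n : H (f n) by exact: upper_dense_subset (Ff n).
exists f; split=> //; split; first by move=> _ [n _ <-].
  split.
    (* Both summands of [f n] are nonnegative, so [f n = 0] would force [g n = 0]. *)
    move=> [n _ fn0]; apply: g0; exists n => //; apply/funext => x.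
    have := congr1 (@^~ x) fn0; rewrite /f /zero_fun => /= fn0x.
    by have := g_ge0 n x; have := c_ge0 n; lra.
  apply/ptws_closureP => A e finA e0.
  have e20 : 0 < e / 2 by rewrite divr_gt0.
  have [N _ cN] := near_infty_natSinv_lt (PosNum e20).
  have [n [Nn gn]] := closure_range_infinitely_often g0 clg N finA e20.
  exists (f n); first by exists n.
  move=> x /gn; rewrite /f /zero_fun !subr0 !ger0_norm ?addr_ge0//.
  have [_ /andP[_ cn] _] := Gc n; have cNn : n.+1%:R^-1 < e / 2 := cN n Nn.
  by move=> gne; rewrite [e]splitr ltrD// (le_lt_trans cn).
move=> _ [n _ <-]; split=> [x|]; first exact: addr_ge0.
by apply: Cp_boundedB => //; exact: Cp_bounded_cst.
Qed.

End Families.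

(** * Covers and families accumulating at zero *)

Lemma finite_nat_bounded (A : set nat) :
  finite_set A -> exists N, forall n, A n -> (n < N)%N.
Proof.
move=> /finite_seqP[s ->]; exists (\max_(i <- s) i.+1)%N => n /= sn.
exact: (@leq_bigmax_seq _ s xpredT S n sn isT).
Qed.

Section Covers.
Context {X : topologicalType}.
Implicit Types (A : set X) (U W : set (set X)).

(** Since [V N] is not all of [X], adding a point outside it to [A] excludes index [N]. *)
Lemma omega_cover_infinitely_often (V : nat -> set X) :
  omega_cover (range V) ->
  forall N A, finite_set A -> exists n, (N <= n)%N /\ A `<=` V n.
Proof.
move=> [[_ VT] ocV]; elim=> [|N IH] A finA.
  by have [_ [n _ <-] AV] := ocV A finA; exists n.
have [x VNx] : exists x, ~ V N x.
  apply/existsNP => VNT; apply: VT; exists N => //.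
  by apply/seteqP; split.
have [|n [Nn AV]] := IH (x |` A).
  by rewrite finite_setU; split=> //; exact: finite_set1.
exists n; split; last by move=> y Ay; apply: AV; right.
rewrite ltn_neqAle Nn andbT; apply/eqP => Nn'.
by apply: VNx; rewrite Nn'; apply: AV; left.
Qed.

Lemma omega_coverP U : omega_cover U <->
  ~ U setT /\ forall A, finite_set A -> exists2 V, U V & A `<=` V.
Proof.
split=> [[[]]//|[UT ocU]]; split=> //; split=> //.
apply/seteqP; split=> // x _.
by have [V UV xV] := ocU [set x] (finite_set1 x); exists V => //; exact: xV.
Qed.

(** An injective sequence in [U] works: each point misses finitely many members, hence finitely many
    indices. *)
Lemma gamma_cover_seq U : gamma_cover U ->
  exists2 V : nat -> set X, (forall n, U (V n)) &
    forall x, exists N, forall n, (N <= n)%N -> V n x.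
Proof.
move=> [_ /infiniteP/pcard_leP[w] finU].
exists w => [n|x]; first exact: funS.
have /finite_nat_bounded[N wN] : finite_set (w @^-1` [set V | U V /\ ~ V x]).
  by apply: finite_preimage (finU x) => i j _ _; apply: 'inj_w; rewrite inE.
exists N => n Nn; apply: contrapT => nwx.
suff : (n < N)%N by rewrite ltnNge Nn.
by apply: wN; split=> //; exact: funS.
Qed.

End Covers.

(** * Sublevel sets of families accumulating at zero *)

Section CoverFamilies.
Context {R : realType} {X : topologicalType}.
Local Notation H := (Cp_bounded R X).
Local Notation zero := (zero_fun R X).
Implicit Types (f g h : {ptws X -> R}) (F G D : set {ptws X -> R}).

(** For [Omega], 0 is not in [F]. For [Gamma], only finitely many members are 0 or reach [e] on [A],
    while [F] is infinite. *)
Lemma families_atP k F A e : families_at k zero H F -> finite_set A -> 0 < e ->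
  exists f, [/\ F f, f <> zero & forall x, A x -> f x < e].
Proof.
case: k => -[FH /= Fk F0] finA e0.
  have [nF0 /ptws_closureP clF] := Fk.
  have [f Ff fe] := clF A e finA e0; exists f; split=> //.
    by move=> f0; apply: nF0; rewrite -f0.
  by move=> x /fe; rewrite subr0; exact: le_lt_trans (ler_norm _).
have [infF finF] := Fk.
have fin : finite_set
    (zero |` \bigcup_(x in A) [set f | F f /\ e <= `|f x - zero x|]).
  rewrite finite_setU; split; first exact: finite_set1.
  by apply: bigcup_finite => // x _; exact: finF.
have [f [Ff nf]] : F `\` (zero |` \bigcup_(x in A)
    [set f | F f /\ e <= `|f x - zero x|]) !=set0.
  apply/set0P/negP => /eqP; rewrite setD_eq0 => sF.
  by apply: infF; exact: sub_finite_set fin.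
exists f; split=> // [f0|x Ax]; first by apply: nf; left.
rewrite ltNge; apply/negP => ef; apply: nf; right; exists x => //; split=> //.
by rewrite subr0 (le_trans ef)// ler_norm.
Qed.

(** A [Gamma] family may contain 0, whose sublevel set is [X] for positive [e]; a cover must not
    contain [X], so 0 is discarded. *)
Definition sublevels F (e : R) : set (set X) :=
  [set [set x | f x < e] | f in F `\ zero].

(** The last hypothesis keeps each sublevel set different from [X]. *)
Lemma open_covers_sublevels k F e : families_at k zero H F -> 0 < e ->
  (forall f, F f -> f <> zero -> exists x, e <= f x) ->
  open_covers X k (sublevels F e).
Proof.
move=> Fk e0 Fe; split; last first.
  move=> _ [f [Ff _] <-]; have [FH _ _] := Fk.
  apply: (@open_comp _ _ f [set y | y < e]); last exact: open_lt.
  by move=> x _; have [cf _] := FH _ Ff; exact: cf.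
have ocU : omega_cover (sublevels F e).
  apply/omega_coverP; split.
    move=> [f [Ff f0] fT]; have [x efx] := Fe f Ff f0.
    by have : [set: X] x by []; rewrite -fT /= ltNge efx.
  move=> A finA; have [f [Ff f0 fA]] := families_atP Fk finA e0.
  by exists [set x | f x < e] => //; exists f.
case: k Fk => [//|] [FH [infF finF] F0].
have sub x :
    [set f | F f /\ e <= f x] `<=` [set f | F f /\ e <= `|f x - zero x|].
  by move=> f [Ff ef]; split=> //; rewrite subr0 (le_trans ef)// ler_norm.
split; first exact: ocU.1.
  move=> finU; apply: infF.
  (* Passing to sublevel sets is finite-to-one: if [f] reaches [e] at [x], so does every [g] with
     the same sublevel set, and only finitely many members do so. *)
  have : finite_set (zero |` \bigcup_(V in sublevels F e)
      [set f | F f /\ f <> zero /\ [set x | f x < e] = V]).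
    rewrite finite_setU; split; first exact: finite_set1.
    apply: bigcup_finite => // _ [f [Ff f0] <-].
    have [x efx] := Fe f Ff f0.
    apply: sub_finite_set (finF e x e0) => g [Fg [g0 gf]]; apply: sub.
    split=> //; rewrite leNgt; apply/negP => gx.
    have : [set x | g x < e] x by [].
    by rewrite gf /= ltNge efx.
  apply: sub_finite_set => f Ff.
  have [->|f0] := pselect (f = zero); [by left|right].
  by exists [set x | f x < e] => //; exists f.
move=> x.
apply: sub_finite_set
  (finite_image (fun f => [set x | f x < e]) (finF e x e0)).
move=> _ [[f [Ff f0] <-] fx]; exists f => //; apply: sub; split=> //.
by rewrite leNgt; apply/negP.
Qed.

(** The sublevels at height [e / 2] witness shrinkability: their closures lie in the closed sets
    where [f <= e / 2]. *)
Lemma shrinkable_sublevels k F e : families_at k zero H F -> 0 < e ->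
  (forall f, F f -> f <> zero -> exists x, e <= f x) ->
  shrinkable_covers X k (sublevels F e).
Proof.
move=> Fk e0 Fe; split; first exact: open_covers_sublevels.
have e20 : 0 < e / 2 by rewrite divr_gt0.
exists (sublevels F (e / 2)).
  apply: open_covers_sublevels => // f Ff f0; have [x ex] := Fe f Ff f0.
  by exists x; lra.
move=> _ [f [Ff f0] <-]; exists [set x | f x < e]; first by exists f.
have [FH _ _] := Fk; have [cf _] := FH _ Ff.
have : closed [set x | f x <= e / 2].
  apply: (@closed_comp _ _ f [set y | y <= e / 2]); last exact: closed_le.
  by move=> x _; exact: cf.
rewrite closure_id => clE.
apply: (@subset_trans _ [set x | f x <= e / 2]).
  by rewrite clE; apply: closureS => x /= /ltW.
by move=> x /=; lra.
Qed.

(** Sublevels of [F n] are taken at height [1 / (n + 1)]. The selected omega-cover captures every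
    finite set at arbitrarily late indices, where the height is below any given [d]. *)
Lemma S1_covers_families k :
  S1 (shrinkable_covers X k) (open_covers X Omega) ->
  S1 (families_at k zero H) (families_at Omega zero H).
Proof.
move=> S F Fk.
pose e n : R := n.+1%:R^-1.
have e0 n : 0 < e n by rewrite invr_gt0 ltr0n.
have e_lt d : 0 < d -> exists N, forall n, (N <= n)%N -> e n < d.
  by move=> d0; have [N _ eN] := near_infty_natSinv_lt (PosNum d0); exists N.
have F0 n f x : F n f -> 0 <= f x.
  by move=> Ff; have [_ _ /(_ f Ff)[zf _]] := Fk n; exact: zf.
suff [b [Fb b0 clb]] : exists b : nat -> {ptws X -> R},
    [/\ forall n, F n (b n), forall n, b n <> zero &
      forall A d, finite_set A -> 0 < d ->
        exists n, forall x, A x -> b n x < d].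
  exists b; split=> //; split.
  - by move=> _ [n _ <-]; have [FH _ _] := Fk n; exact: FH.
  - split; first by move=> [n _ /b0].
    apply/ptws_closureP => A d finA d0; have [n bn] := clb A d finA d0.
    exists (b n); first by exists n.
    by move=> x Ax; rewrite subr0 ger0_norm ?bn// (F0 _ _ _ (Fb n)).
  - by move=> _ [n _ <-]; have [_ _ FH] := Fk n; exact: FH.
pose small n f := forall x, f x < e n.
(* Either nonzero functions uniformly below [e n] occur for arbitrarily late [n], and choosing them
   suffices, or from [M] on every nonzero member reaches [e n] and its sublevel set is proper. *)
have [often|/existsNP[M rare]] := pselect (forall N : nat, exists n f,
    [/\ (N <= n)%N, F n f, f <> zero & small n f]).
  have /choice[b bP] n : exists f, [/\ F n f, f <> zero &
      (exists g, [/\ F n g, g <> zero & small n g]) -> small n f].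
    have [[f [Ff f0 sf]]|nex] :=
        pselect (exists g, [/\ F n g, g <> zero & small n g]).
      by exists f.
    have [f [Ff f0 _]] := families_atP (Fk n) (finite_set0 _) ltr01.
    by exists f; split=> // /nex.
  exists b; split=> [n|n|A d _ d0]; [by have [] := bP n|by have [] := bP n|].
  have [N eN] := e_lt d d0; have [n [f [Nn Ff f0 sf]]] := often N.
  exists n => x _; apply: lt_trans (eN n Nn); have [_ _] := bP n; apply.
  by exists f.
have coverF n : shrinkable_covers X k (sublevels (F (n + M)%N) (e (n + M)%N)).
  apply: shrinkable_sublevels => // f Ff f0.
  apply: contrapT => /forallNP nx; apply: rare; exists (n + M)%N, f.
  split=> // [|x]; first exact: leq_addl.
  by rewrite ltNge; apply/negP; exact: nx.
have [V [UV [ocV _]]] := S _ coverF.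
have /choice[f fP] n : exists f,
    [/\ F (n + M)%N f, f <> zero & [set x | f x < e (n + M)%N] = V n].
  by have [f [Ff f0] fV] := UV n; exists f.
have /choice[g gP] n : exists g, F n g /\ g <> zero.
  have [g [Fg g0 _]] := families_atP (Fk n) (finite_set0 _) ltr01.
  by exists g.
(* The covers start at index [M]; earlier indices get an arbitrary nonzero member. *)
exists (fun n => if (M <= n)%N then f (n - M)%N else g n).
split=> [n|n|A d finA d0].
- case: leqP => [Mn|_]; last exact: (gP n).1.
  by have [+ _ _] := fP (n - M)%N; rewrite subnK.
- case: leqP => [Mn|_]; last exact: (gP n).2.
  by have [_ + _] := fP (n - M)%N.
have [N eN] := e_lt d d0.
have [n [Nn AV]] := omega_cover_infinitely_often ocV N finA.
have [_ _ fV] := fP n.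
exists (n + M)%N => x /AV; rewrite -fV leq_addl addnK /= => /lt_trans; apply.
by apply: eN; rewrite (leq_trans Nn)// leq_addr.
Qed.

End CoverFamilies.

(** * Normality, separability and i-weight *)

Section NormalDomain.
Context {R : realType} {X : topologicalType}.
Local Notation H := (Cp_bounded R X).
Implicit Types (f g h : {ptws X -> R}) (F G D : set {ptws X -> R}).
Hypothesis normalX : normal_space X.

Lemma normal_raise h (W U : set X) : H h -> open U -> closure W `<=` U ->
  exists g, [/\ H g, fle h g, forall x, W x -> g x = h x
    & forall x, ~ U x -> 1 <= g x].
Proof.
move=> Hh oU WU; have [_ [M hM]] := (Cp_boundedP _).1 Hh.
have /(uniform_separatorP (R := R))[u [cu u01 u0 u1]] :
    uniform_separator (closure W) (~` U).
  apply: (normal_separatorP (R := R)).1 => //.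
  - exact: closed_closure.
  - exact: open_closedC.
  - by apply/disjoints_subset; rewrite setCK.
have u_ge0 x : 0 <= u x <= 1.
  by have := u01 _ (imageT u x); rewrite /= in_itv.
have Hu : H u.
  apply/Cp_boundedP; split=> //; exists 1 => x.
  by have /andP[? ?] := u_ge0 x; rewrite ger0_norm.
(* Since [h] is at least minus the absolute value of [M], this multiple of the Urysohn function [u]
   lifts it to at least 1 off [U]. *)
exists (fun x => h x + (`|M| + 1) * u x); split.
- by apply: Cp_boundedD => //; apply: Cp_boundedM => //; exact: Cp_bounded_cst.
- move=> x; rewrite lerDl mulr_ge0 ?addr_ge0//.
  by have /andP[] := u_ge0 x.
- move=> x /subset_closure Wx; have -> : u x = 0 by apply: u0; exists x.
  by rewrite mulr0 addr0.
- move=> x Ux; have -> : u x = 1 by apply: u1; exists x.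
  have := hM x; have := ler_norm M; have := ler_norm (- h x).
  by rewrite normrN; lra.
Qed.

(** A function of this set that is below 1 on [A] certifies that some member of [U] contains [A]. *)
Definition raised_off (U : set (set X)) : set {ptws X -> R} :=
  [set g | H g /\ exists2 V, U V & forall x, ~ V x -> 1 <= g x].

(** Raising [h] off a member of [U] leaves it unchanged on a member of the shrinking [W]. For
    [Omega] that member contains the given finite set; for [Gamma] the raised functions are
    eventually equal to the target at each point. *)
Lemma upper_dense_raised_off k U : shrinkable_covers X k U ->
  upper_dense_subsets k H (raised_off U).
Proof.
move=> [[_ oU] [W [kW _] WU]].
have raise h V : H h -> W V -> exists g,
    [/\ raised_off U g, fle h g & forall x, V x -> g x = h x].
  move=> Hh /WU[V' UV' VV'].
  have [g [Hg hg gh g1]] := normal_raise Hh (oU _ UV') VV'.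
  by exists g; split=> //; split=> //; exists V'.
case: k kW => /= [[_ ocW]|/gamma_cover_seq[V WV VN]].
  apply/upper_denseP; split=> [f []//|h A e Hh finA e0].
  have [V WV AV] := ocW A finA; have [g [Ug hg gh]] := raise h V Hh WV.
  by exists g; split=> // x /AV /gh ->; rewrite subrr normr0.
split=> [f []//|f Hf].
have /choice[g gP] n := raise f (V n) Hf (WV n).
exists g; split=> [n|x|n]; [by have [] := gP n| |].
  have [N VNx] := VN x; apply: cvg_near_cst.
  by exists N => // n /= /VNx; have [_ _] := gP n; exact.
have [[Hg _] fg _] := gP n; split=> //; exact: Cp_boundedB.
Qed.

Lemma S1_upper_dense_covers k :
  S1 (upper_dense_subsets k H) (dense_subsets H) ->
  S1 (shrinkable_covers X k) (open_covers X Omega).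
Proof.
move=> S U shU.
have [g [Ug [_ /(_ _ (Cp_bounded_cst 0)) /ptws_closureP clg]]] :=
  S (fun n => raised_off (U n)) (fun n => upper_dense_raised_off (shU n)).
have /choice[V VP] n : exists V, U n V /\ forall x, ~ V x -> 1 <= g n x.
  by have [_ [V UV gV]] := Ug n; exists V.
exists V; split=> [n|]; first exact: (VP n).1.
split; last first.
  by move=> _ [n _ <-]; have [[_ oU] _] := shU n; apply: oU; exact: (VP n).1.
apply/omega_coverP; split.
  move=> [n _ VT]; have [[kU _] _] := shU n.
  have UT : U n setT by rewrite -VT; exact: (VP n).1.
  by case: k kU {S shU Ug clg VP} => [[[]]|[[]]].
(* A selected function within 1 of 0 on [A] cannot have a point of [A] outside [V n]. *)
move=> A finA; have [_ [n _ <-] gn] := clg A 1 finA ltr01.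
exists (V n); first by exists n.
move=> x Ax; apply: contrapT => /(VP n).2; apply/negP.
by rewrite -ltNge; apply: le_lt_trans (gn x Ax); rewrite subr0 ler_norm.
Qed.

End NormalDomain.

Lemma hausdorff_separated (R : realType) (Y : topologicalType) (I : Type)
    (u : I -> Y -> R) :
  (forall i, continuous (u i)) ->
  (forall p q, (forall i, u i p = u i q) -> p = q) -> hausdorff_space Y.
Proof.
move=> cu sepu p q pq; apply: sepu => i.
apply: (@norm_hausdorff R R^o) => A B pA qB.
have [y [Ay By]] := pq _ _ (cu i p _ pA) (cu i q _ qB).
by exists (u i y).
Qed.

(** * The coarser topology given by countably many separating functions *)

Section InitialTopology.
Context {R : realType} {X : topologicalType} (d : nat -> {ptws X -> R}).
Hypothesis d_cont : forall n, continuous (d n : X -> R).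
Hypothesis d_sep : forall x y, (forall n, d n x = d n y) -> x = y.

Definition evaluation (x : X) : {ptws nat -> R} := fun n => d n x.

Local Notation Y := (initial_topology evaluation).

Lemma evaluation_coord_continuous n : continuous (d n : Y -> R).
Proof.
move=> y; have c1 := @initial_continuous _ _ evaluation y.
have c2 := @proj_continuous nat (fun=> R) n (evaluation y).
exact: (cvg_comp _ _ c1 c2).
Qed.

Lemma initial_evaluation_hausdorff : hausdorff_space Y.
Proof. exact: (hausdorff_separated evaluation_coord_continuous d_sep). Qed.

(** An entry [(n, (a, b))] confines [d n] strictly between [a] and [b]; coding by finite lists of
    rationals makes the family countable. *)
Definition rat_box (s : seq (nat * (rat * rat))) : set Y :=
  [set y | forall t, t \in s -> ratr t.2.1 < d t.1 y < ratr t.2.2].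

Lemma rat_box_basis : basis (range rat_box).
Proof.
split=> [_ [s _ <-]|y B].
  elim: s => [|t s IH].
    rewrite (_ : rat_box [::] = setT); first exact: openT.
    exact/seteqP.
  rewrite (_ : rat_box (t :: s) =
      d t.1 @^-1` `]ratr t.2.1, ratr t.2.2[ `&` rat_box s).
    apply: openI => //.
    apply: (@open_comp Y R (d t.1)); last exact: interval_open.
    by move=> z _; exact: evaluation_coord_continuous.
  apply/seteqP; split=> z /=; rewrite in_itv /=; [move=> zts|move=> [zt zs] t'].
    split; first by apply: zts; exact: mem_head.
    by move=> t' t's; apply: zts; rewrite inE t's orbT.
  by rewrite inE => /predU1P[->//|]; exact: zs.
move=> [_ [[V oV <-] Vy VB]].
have : nbhs (evaluation y) V by apply: open_nbhs_nbhs; split.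
move=> /nbhs_ptwsP[A [e [/finite_seqP[r Ar] e0 AV]]].
(* Rational endpoints within [e] of [d n y], on either side, fit a rational box into the given
   neighbourhood. *)
have /choice[a aP] n : exists q : rat, d n y - e < ratr q < d n y.
  have /rat_in_itvoo[q] : d n y - e < d n y by rewrite gtrBl.
  by rewrite in_itv; exists q.
have /choice[b bP] n : exists q : rat, d n y < ratr q < d n y + e.
  have /rat_in_itvoo[q] : d n y < d n y + e by rewrite ltrDl.
  by rewrite in_itv; exists q.
exists (rat_box [seq (n, (a n, b n)) | n <- r]).
  split; first by exists [seq (n, (a n, b n)) | n <- r].
  move=> _ /mapP[n _ ->] /=; have /andP[_ ->] := aP n.
  by have /andP[-> _] := bP n.
move=> z zr; apply: VB; apply: AV => n; rewrite Ar /= => nr.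
have /= /andP[az bz] := zr _ (map_f (fun n => (n, (a n, b n))) nr).
have /andP[aP1 _] := aP n; have /andP[_ bP2] := bP n.
rewrite /evaluation ltr_norml; apply/andP; split; lra.
Qed.

(** The identity is the condensation; the initial topology comes from a uniformity, hence is
    completely regular. *)
Lemma condenses_le_initial : condenses_le X nat.
Proof.
exists Y, (fun x => x); split.
- apply: continuous_comp_initial => x; apply/pointwise_cvgP => n.
  exact: d_cont.
- by exists (fun x => x).
- split; last exact: initial_evaluation_hausdorff.
  exact: (@uniform_completely_regular R).
- exists (range rat_box); first exact: rat_box_basis.
  apply: card_le_trans (card_image_le _ _) _.
  exact: (countableP _).
Qed.

End InitialTopology.

(** * Separability of the function space and countable i-weight *)

Section Separability.
Context {R : realType} {X : topologicalType}.
Local Notation H := (Cp_bounded R X).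

Lemma separable_iweight : normal_space X -> hausdorff_space X ->
  separable H -> iweight_eq X nat.
Proof.
move=> normalX hausdorffX [D cD [DH HD]].
split; [exact: infinite_nat| |by move=> L /infiniteP].
have D0 : D !=set0.
  have [f [Df _]] := HD _ (Cp_bounded_cst 0) setT filterT.
  by exists f.
have [d dD] := countable_enum D0 cD.
have Dd n : D (d n) by rewrite -dD; exists n.
apply: (@condenses_le_initial _ _ d) => [n|x y dxy].
  by have [cd _] := DH _ (Dd n); exact: cd.
apply: contrapT => xy.
have cl1 := accessible_closed_set1 (hausdorff_accessible hausdorffX).
(* Raising 0 off the complement of [y] gives [g] with [g x = 0] and [g y >= 1]; a member of [D]
   within 1/2 of [g] at both points separates them. *)
have [|| g [Hg _ gx gy]] :=
    @normal_raise R _ normalX _ [set x] (~` [set y]) (Cp_bounded_cst 0).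
- by apply: closed_openC; exact: cl1.
- rewrite -(closure_id _).1; last exact: cl1.
  by move=> _ -> /= yx; apply: xy.
have fin : finite_set [set x; y].
  by rewrite finite_setU; split; exact: finite_set1.
have e0 : 0 < 2^-1 :> R by rewrite invr_gt0.
have [f + dg] := (ptws_closureP _ _).1 (HD _ Hg) _ _ fin e0.
rewrite -dD => -[n _ dn]; move: dg; rewrite -{f}dn => dg.
have := dg x (or_introl erefl); have := dg y (or_intror erefl).
have := gy y (fun h => h erefl); rewrite (gx x erefl) dxy.
by rewrite !ltr_norml => {dD xy} ? /andP[? ?] /andP[? ?]; lra.
Qed.

(** For each pair of basic sets, one function that vanishes nowhere on the first and everywhere off
    the second is fixed, if any exists. Complete regularity provides enough such pairs. *)
Lemma condenses_separating (x0 : X) : condenses_le X nat ->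
  exists u : nat * nat -> {ptws X -> R}, (forall k, H (u k)) /\
    forall x y, x <> y -> exists k, u k x <> 0 /\ u k y = 0.
Proof.
move=> [Y [f [cf [f' fK _] [crY hY] [B [oB bB] cB]]]].
have B0 : B !=set0.
  by have [V [BV _] _] := bB (f x0) setT filterT; exists V.
have [b bE] := countable_enum B0 cB.
pose good (V U : set Y) (v : Y -> R) := [/\ continuous v, forall y, `|v y| <= 1,
  forall y, V y -> v y <> 0 & forall y, ~ U y -> v y = 0].
have /choice[v vP] (ij : nat * nat) : exists v : Y -> R,
    (continuous v /\ forall y, `|v y| <= 1) /\
    ((exists w, good (b ij.1) (b ij.2) w) -> good (b ij.1) (b ij.2) v).
  have [[w gw]|nex] := pselect (exists w, good (b ij.1) (b ij.2) w).
    by exists w; split=> //; have [] := gw.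
  exists (fun=> 0); split=> //; split=> [|y]; first exact: cst_continuous.
  by rewrite normr0 ler01.
exists (fun ij => v ij \o f); split=> [ij|x y xy].
  have [[cv v1] _] := vP ij; apply/Cp_boundedP; split; last first.
    by exists 1 => x; exact: v1.
  by move=> x; apply: continuous_comp; [exact: cf|exact: cv].
have fxy : f x != f y by apply/eqP => /(can_inj fK).
have [j [bx by_]] : exists j, b j (f x) /\ ~ b j (f y).
  move: hY; rewrite open_hausdorff => /(_ _ _ fxy)[[U V] /= [+ +] [oU oV UV]].
  rewrite !inE => Ux Vy.
  have [W [BW Wx] WU] := bB (f x) U (open_nbhs_nbhs (conj oU Ux)).
  move: BW; rewrite -bE => -[j _ jW]; exists j; rewrite jW; split=> // /WU Uy.
  by move: UV => /eqP/seteqP[/(_ (f y)) + _]; apply; split.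
have ob n : open (b n) by apply: oB; rewrite -bE; exists n.
have /(uniform_separatorP (R := R))[w [cw w01 w0 w1]] :
    uniform_separator [set f x] (~` b j).
  by apply: crY; [exact: open_closedC|exact].
have wx : w (f x) = 0 by apply: w0; exists (f x).
have [i [bix iw]] : exists i, b i (f x) /\ b i `<=` [set y | w y < 1].
  have oW : open [set y | w y < 1].
    apply: (@open_comp _ _ w [set z | z < 1]); last exact: open_lt.
    by move=> z _; exact: cw.
  have [|W [BW Wx] Ww] := bB (f x) [set y | w y < 1].
    by apply: open_nbhs_nbhs; split=> //=; rewrite wx ltr01.
  by move: BW; rewrite -bE => -[i _ iW]; exists i; rewrite iW.
have [_ vg] := vP (i, j); have [|_ _ v0 v1] := vg.
  (* [1 - w] is positive on [b i], where [w < 1], and zero off [b j], where [w = 1]. *)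
  exists (fun y => 1 - w y); split=> /= [|z|z /iw /= wz|z bjz].
  - by move=> z; apply: (@cvgB _ R^o); [exact: cvg_cst|exact: cw].
  - have := w01 _ (imageT w z); rewrite /= in_itv /= => /andP[? ?].
    by rewrite ger0_norm; lra.
  - by apply/eqP; rewrite gt_eqF// subr_gt0.
  - by have -> : w z = 1; [apply: w1; exists z|rewrite subrr].
by exists (i, j); split=> /=; [exact: v0|exact: v1].
Qed.

(** A pair [(q, l)] codes the monomial with coefficient [q] and variables listed in [l] with
    multiplicity. *)
Definition rat_polynomial (K : Type) (u : K -> {ptws X -> R})
    (s : seq (rat * seq K)) : {ptws X -> R} :=
  fun x => \sum_(t <- s) ratr t.1 * \prod_(k <- t.2) u k x.

(** Newton-style interpolation: points are treated one at a time, each corrected by a monomial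
    vanishing at the points already treated. *)
Lemma separating_separable (K : countType) (u : K -> {ptws X -> R}) :
  (forall k, H (u k)) ->
  (forall x y, x <> y -> exists k, u k x <> 0 /\ u k y = 0) -> separable H.
Proof.
move=> Hu sepu; exists (range (rat_polynomial u)).
  by apply: card_le_trans (card_image_le _ _) _; exact: (countableP _).
split=> [_ [s _ <-]|h Hh].
  elim: s => [|t s IH].
    rewrite (_ : rat_polynomial _ _ = (fun=> 0)); first exact: Cp_bounded_cst.
    by apply/funext => x; rewrite /rat_polynomial big_nil.
  rewrite (_ : rat_polynomial _ _ = fun x =>
      ratr t.1 * \prod_(k <- t.2) u k x + rat_polynomial u s x); last first.
    by apply/funext => x; rewrite /rat_polynomial big_cons.
  apply: Cp_boundedD => //; apply: Cp_boundedM; first exact: Cp_bounded_cst.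
  elim: t.2 => [|k l IHl].
    rewrite (_ : (fun x => _) = (fun=> 1)); first exact: Cp_bounded_cst.
    by apply/funext => x; rewrite big_nil.
  rewrite (_ : (fun x => _) = fun x => u k x * \prod_(j <- l) u j x).
    exact: Cp_boundedM.
  by apply/funext => x; rewrite big_cons.
apply/ptws_closureP => A e /finite_seqP[r ->] e0 {A}.
suff [s sP] : exists s, forall x, x \in r -> `|rat_polynomial u s x - h x| < e.
  by exists (rat_polynomial u s) => //; exists s.
elim: r => [|x r [s sP]]; first by exists [::].
have [xr|xr] := boolP (x \in r).
  by exists s => y; rewrite inE => /predU1P[->|]; exact: sP.
have [l [lx lr]] : exists l : seq K, \prod_(k <- l) u k x != 0 /\
    forall y, y \in r -> \prod_(k <- l) u k y = 0.
  elim: r xr {sP} => [|y r IH]; first by exists [::]; rewrite big_nil oner_neq0.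
  rewrite inE negb_or => /andP[xy /IH[l [lx lr]]].
  have [k [kx ky]] := sepu x y (elimN eqP xy).
  exists (k :: l); rewrite big_cons mulf_neq0//; last exact/eqP.
  split=> // z; rewrite inE big_cons => /predU1P[->|/lr ->].
    by rewrite ky mul0r.
  by rewrite mulr0.
set p := \prod_(k <- l) u k x in lx.
(* [c] is the coefficient that interpolates exactly at [x]; a rational within [e] over the absolute
   value of [p] leaves an error below [e]. *)
pose c := (h x - rat_polynomial u s x) / p.
have ep : 0 < e / `|p| by rewrite divr_gt0// normr_gt0.
have /rat_in_itvoo[q] : c - e / `|p| < c + e / `|p|.
  by rewrite ltrBlDr -addrA ltrDl addr_gt0.
rewrite in_itv -ltr_distl => qc.
exists ((q, l) :: s) => y; rewrite inE => /predU1P[->|yr]; last first.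
  by rewrite /rat_polynomial big_cons /= lr// mulr0 add0r; exact: sP.
rewrite /rat_polynomial big_cons /= -/p -/(rat_polynomial u s x).
have -> : ratr q * p + rat_polynomial u s x - h x = (ratr q - c) * p.
  by rewrite mulrBl divfK//; lra.
by rewrite normrM -ltr_pdivlMr ?normr_gt0.
Qed.

End Separability.

Theorem theorem8p2 (R : realType) (X : topologicalType) (k : kind)
  (infiniteX : infinite_set [set: X])
  (normalX : normal_space X) (hausdorffX : hausdorff_space X) :
  let H := Cp_bounded R X in
  let zero := zero_fun R X in
  [<-> S1 (upper_dense_subsets k H) (dense_subsets H);
       iweight_eq X nat /\ S1 (shrinkable_covers X k) (open_covers X Omega);
       separable H /\ S1 (families_at k zero H) (families_at Omega zero H);
       separable H /\ S1 (upper_dense_subsets k H) (families_at Omega zero H)].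
Proof.
move=> H zero.
have [x0 _] : [set: X] !=set0.
  by apply/set0P/eqP => X0; apply: infiniteX; rewrite X0.
tfae.
- move=> S; split; last exact: S1_upper_dense_covers S.
  apply: (separable_iweight (R := R)) => //.
  (* [H] is upper dense in itself, so selecting from the constant sequence [H] yields a countable
     dense set. *)
  have [a [_ aH]] := S (fun=> H) (fun=> upper_dense_full k).
  exists (range a) => //.
  by apply: card_le_trans (card_image_le _ _) _; exact: (countableP _).
- move=> [[_ cX _] S]; split; last exact: S1_covers_families S.
  have [u [Hu sepu]] := condenses_separating (R := R) x0 cX.
  exact: separating_separable Hu sepu.
- by move=> [sepH S]; split=> //; exact: S1_families_upper_dense x0 S.
- by move=> [sepH S]; exact: S1_upper_dense_dense S.
Qed.
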